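(* Let $m$ be a positive integer, $n=2^m-1$, and let $\mathcal C\subseteq \mathbb F G$ be a nonzero affine-invariant code with error-correction capability $t$. Let $I\subseteq G=\{0,\alpha^0,\dots,\alpha^{n-1}\}$ be an information set for $\mathcal C$, and put $I'=I\setminus\{0\}$ (so $I'=I$ if $0\notin I$). Let $s\le t$ be a nonnegative integer and let $P\subseteq \mathrm{PAut}(\mathcal C^* )\subseteq \mathrm{PAut}(\mathcal C)$ be an $s$-PD-like set for $\mathcal C$ with respect to $I'$. Then Algorithm II, run with $I$, any parity check matrix $H$ of $\mathcal C$ in standard form with respect to $I$, and $P$, corrects up to $s$ errors: for every $c\in\mathcal C$ and every $e\in\mathbb F G$ with $\omega(e)\le s$, Algorithm II on input $r=c+e$ stops successfully and outputs $c$.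
   Context: Ambient space. $\mathbb F=\mathbb F_2$; $G$ is the additive group of the field $\mathbb F_{2^m}$, $n=2^m-1$, $G^*=G\setminus\{0\}$, and $\alpha$ is a fixed generator of the cyclic multiplicative group $G^*$. Elements of the group algebra $\mathbb F G$ are written $bX^0+\sum_{i=0}^{n-1}a_iX^{\alpha^i}$ with $b,a_i\in\mathbb F$; positions are indexed by elements of $G$. A code is an ideal $\mathcal C\subseteq\mathbb F G$. The weight $\omega(v)$ of a vector is its number of nonzero entries. The error-correction capability of a nonzero code with minimum distance $d$ is $t=\lfloor (d-1)/2\rfloor$. Permutations. $S_G$ is the group of permutations of the set $G$, acting on $\mathbb F G$ by $\tau\left(bX^0+\sum_i a_iX^{\alpha^i}\right)=bX^{\tau(0)}+\sum_i a_iX^{\tau(\alpha^i)}$, and $\mathrm{PAut}(\mathcal C)=\{\tau\in S_G: \tau(\mathcal C)=\mathcal C\}$. Affine-invariant codes. $\mathcal C$ is an extended cyclic code if for every $bX^0+\sum_i a_iX^{\alpha^i}\in\mathcal C$ one has $bX^0+\sum_i a_iX^{\alpha^{i+1}}\in\mathcal C$ and $b+\sum_i a_i=0$. $\mathcal C$ is affine-invariant if it is extended cyclic and every map $x\mapsto ax+b$ on $G$ ($a\in G^*$, $b\in G$) belongs to $\mathrm{PAut}(\mathcal C)$. $\mathcal C^*\subseteq\mathbb F G^*$ is the code obtained from $\mathcal C$ by puncturing at the position $X^0$. $\mathrm{PAut}(\mathcal C^* )$ is the group of permutations of $G^*$ preserving $\mathcal C^*$; each such permutation is identified with its extension to $G$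 fixing $0$, so that $\mathrm{PAut}(\mathcal C^* )\subseteq\mathrm{PAut}(\mathcal C)$. Information sets. If $\mathcal C$ has dimension $k$, a set $I\subseteq G$ is an information set for $\mathcal C$ if $|I|=k$ and the projection of $\mathcal C$ onto the positions in $I$ is all of $\mathbb F^{|I|}$. A parity check matrix $H$ of $\mathcal C$ (a matrix whose rows form a basis of the dual code) is in standard form with respect to $I$ if its columns at the positions not in $I$ are the columns of the identity matrix of order $2^m-k$. PD-like sets. For $J\subseteq G^*$, a set $P\subseteq\mathrm{PAut}(\mathcal C^* )$ is an $s$-PD-like set for $\mathcal C$ with respect to $J$ if for every $s$-element subset $B\subseteq G^*$ there is $\tau\in P$ with $\tau(B)\cap J=\emptyset$. Algorithm II. For $k=0,\dots,n-1$ let $\sigma_k\in\mathrm{PAut}(\mathcal C)$ be the translation $x\mapsto x+\alpha^k$ of $G$, and let $\Sigma$ be the ordered set $(1_G,\sigma_0,\dots,\sigma_{n-1})$, where $1_G$ is the identity. Given an information set $I$, a parity check matrix $H$ in standard form with respect to $I$, a set $P\subseteq\mathrm{PAut}(\mathcal C^* )$ and a received word $r\in\mathbb F G$: run through the elements $\sigma$ of $\Sigma$ in order and, for each, through all $\tau\in P$ (in any fixed order), until a pair $(\sigma,\tau_0)$ is found with $\omega\left(H\cdot \tau_0(\sigma(r))^T\right)\le t$. Then let $c'\in\mathcal C$ be the unique codeword agreeing with $\tau_0(\sigma(r))$ on the positions in $I$, and output $\sigma^{-1}(\tau_0^{-1}(c'))$. *)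

(* Defs.v *)
From HB Require Import structures.
From mathcomp Require Import all_boot all_order all_algebra all_fingroup.
From mathcomp Require Import all_solvable all_field.

Set Implicit Arguments.
Unset Strict Implicit.
Unset Printing Implicit Defensive.

Import GRing.Theory.
Local Open Scope ring_scope.

(* The positions T are G (words are then elements of the group algebra F_2 G)
   or G^* = {unit G}. ('F_2)^o is 'F_2 seen as a vector space over itself, so
   that codes can be subspaces of type {vspace word T}. *)
Notation word T := {ffun T -> ('F_2)^o}.

Definition weight (J : finType) (v : J -> 'F_2) : nat := #|[set x | v x != 0]|.

Section Words.
Variable T : finType.
Implicit Types (v : word T) (C : {pred word T}) (tau : {perm T}).

Definition Xpow (x : T) : word T := [ffun y => (y == x)%:R].

Definition perm_act tau v : word T := \sum_(x : T) v x *: Xpow (tau x).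

Definition PAut C : {set {perm T}} :=
  [set tau | perm_act tau @: C == [set v in C]].

(* The default value #|T| is an upper bound of all distances, hence it is
   irrelevant as soon as C has two distinct words. *)
Definition min_distance C : nat :=
  \big[minn/#|T|]_(p : word T * word T |
     [&& p.1 \in C, p.2 \in C & p.1 != p.2]) weight (p.1 - p.2).

Definition capability C : nat := ((min_distance C - 1) %/ 2)%N.

Definition dual_code C : {set word T} :=
  [set v : word T |
     [forall c : word T in C, \sum_(x : T) (v x : 'F_2) * c x == 0]].

(* The columns of a matrix with #|T| columns are indexed by T through
   enum_rank / enum_val. *)
Definition row_word r (H : 'M['F_2]_(r, #|T|)) (i : 'I_r) : word T :=
  [ffun x => H i (enum_rank x)].

Definition word_row v : 'rV['F_2]_#|T| := \row_j v (enum_val j).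

Definition syndrome_weight r (H : 'M['F_2]_(r, #|T|)) v : nat :=
  weight (fun i : 'I_r => (H *m (word_row v)^T) i 0).

Definition parity_check C r (H : 'M['F_2]_(r, #|T|)) : Prop :=
  let rows := [seq row_word H i | i <- enum 'I_r] in
  free rows /\ (forall v, (v \in <<rows>>%VS) = (v \in dual_code C)).

(* The columns of the identity matrix may occur in any order: f i is the
   position, outside I, of the i-th one. *)
Definition standard_form (I : {set T}) r (H : 'M['F_2]_(r, #|T|)) : Prop :=
  exists f : 'I_r -> T,
    [/\ injective f, f @: [set: 'I_r] = ~: I
      & forall i, col (enum_rank (f i)) H = col i 1%:M].

Definition projection (I : {set T}) v : {ffun {x : T | x \in I} -> 'F_2} :=
  [ffun x => v (val x)].

Definition info_set (C : {vspace word T}) (I : {set T}) : Prop :=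
  #|I| = \dim C /\ projection I @: C = [set: {ffun {x : T | x \in I} -> 'F_2}].

End Words.

Section AffineInvariant.
Variable G : finFieldType.
Implicit Types (C : {vspace word G}) (alpha : {unit G}).

Definition ga_mul (u v : word G) : word G :=
  \sum_(g : G) \sum_(h : G) (u g * v h) *: Xpow (g + h).

Definition ga_ideal C : Prop :=
  forall u v : word G, v \in C -> ga_mul u v \in C.

Definition extended_cyclic (n : nat) alpha C : Prop :=
  forall (b : 'F_2) (a : 'I_n -> 'F_2),
    b *: Xpow 0 + \sum_(i < n) a i *: Xpow (val alpha ^+ i) \in C ->
    b *: Xpow 0 + \sum_(i < n) a i *: Xpow (val alpha ^+ i.+1) \in C
    /\ b + \sum_(i < n) a i = 0.

Lemma affine_inj (a : {unit G}) (b : G) : injective (fun x => val a * x + b).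
Proof. by move=> x y /addIr /(mulrI (valP a)). Qed.

Definition affine_perm (a : {unit G}) (b : G) : {perm G} :=
  perm (@affine_inj a b).

Definition affine_invariant (n : nat) alpha C : Prop :=
  extended_cyclic n alpha C
  /\ (forall (a : {unit G}) (b : G), affine_perm a b \in PAut C).

Definition puncture (v : word G) : word {unit G} := [ffun u => v (val u)].

Definition ext0_fun (p : {perm {unit G}}) (x : G) : G :=
  if insub x is Some u then val (p u) else 0.

Lemma ext0_inj p : injective (ext0_fun p).
Proof.
have E0 (x : G) : x \isn't a GRing.unit -> x = 0.
  by rewrite unitfE negbK => /eqP.
have N0 (u : {unit G}) : val u <> 0.
  by move=> u0; have := valP u; rewrite /= unitfE u0 eqxx.
rewrite /ext0_fun => x y; case: insubP => [u _ <-|/E0->].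
  case: insubP => [w _ <-|_ /N0 //].
  by move=> /val_inj /perm_inj ->.
by case: insubP => [w _ _ /esym /N0 //|/E0->].
Qed.

Definition ext0 (p : {perm {unit G}}) : {perm G} := perm (@ext0_inj p).

(* PAut of the punctured code, seen inside the permutations of G that fix 0. *)
Definition PAut_star C : {set {perm G}} :=
  ext0 @: PAut (puncture @: C).

Definition PD_like (s : nat) C (J : {set G}) (P : {set {perm G}}) : Prop :=
  [/\ 0 \notin J, P \subset PAut_star C
    & forall B : {set G}, 0 \notin B -> #|B| = s ->
        exists2 tau : {perm G}, tau \in P & (tau @: B) :&: J = set0].

Definition translation (b : G) : {perm G} := perm (@addIr G b).

Definition Sigma (n : nat) alpha : seq {perm G} :=
  1%g :: [seq translation (val alpha ^+ k) | k <- iota 0 n].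

(* ps enumerates the set P in the order in which it is searched. The result is
   None when no pair (sigma, tau) passes the test; when I is an information set
   of C, exactly one codeword satisfies the condition given to pick. *)
Definition algorithmII (n : nat) alpha C (t : nat) (I : {set G}) r
    (H : 'M['F_2]_(r, #|G|)) (ps : seq {perm G}) (w : word G)
    : option (word G) :=
  let test p := (syndrome_weight H (perm_act p.2 (perm_act p.1 w)) <= t)%N in
  if ohead [seq p <- [seq (sigma, tau) | sigma <- Sigma n alpha, tau <- ps]
             | test p] is Some (sigma, tau0)
  then omap (fun c' => perm_act sigma^-1%g (perm_act tau0^-1%g c'))
         [pick c' : word G | (c' \in C)
            && [forall x in I, c' x == perm_act tau0 (perm_act sigma w) x]]
  else None.

End AffineInvariant.

(* Main.v *)
Require Import Defs.
From HB Require Import structures.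
From mathcomp Require Import all_boot all_order all_algebra all_fingroup.
From mathcomp Require Import all_solvable all_field.

(* The syndrome with respect to a parity check matrix in
   standard form is, for a word vanishing on I, a copy of the word. If a pair
   (sigma, tau) passes the test, the received word moved by it is thus within
   distance t of the codeword agreeing with it on I, and also within distance t
   of the moved transmitted codeword: the two codewords coincide. Some pair
   passes: an error pattern E with at most s elements is not all of G, so a
   translation sigma moves it into G^*, and an element tau of P then moves it off
   I' while fixing 0, hence off I. *)

Set Implicit Arguments.
Unset Strict Implicit.
Unset Printing Implicit Defensive.

Import GRing.Theory.
Local Open Scope ring_scope.

(** A PD-like set is only tested on sets of exactly [s] elements, while an error pattern may be
    smaller; elements drawn from [D :\: A] fill the gap. *)
Lemma extend_set (T : finType) (A D : {set T}) (s : nat) :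
    A \subset D -> (#|A| <= s <= #|D|)%N ->
  exists2 B : {set T}, A \subset B /\ B \subset D & #|B| = s.
Proof.
move=> sAD /andP[leAs lesD].
have /card_geqP[l [Ul szl lDA]] : (s - #|A| <= #|D :\: A|)%N.
  by rewrite cardsDS // leq_sub2r.
exists (A :|: [set:: l]).
  split; first exact: subsetUl.
  rewrite subUset sAD /=; apply/subsetP=> x; rewrite inE => /lDA.
  by case/setDP.
rewrite cardsU cardsE (card_uniqP Ul) szl subnKC //.
suff -> : A :&: [set:: l] = set0 by rewrite cards0 subn0.
apply/setP=> x; rewrite !inE; apply/andP => -[xA /lDA].
by rewrite inE xA.
Qed.

(** * Words, coordinate permutations and weights *)

Section Words.
Variable T : finType.
Implicit Types (v w c : word T) (t : {perm T}).

Lemma sum_XpowE (J : finType) (a : J -> 'F_2) (f : J -> T) (y : T) :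
  (\sum_j a j *: Xpow (f j) : word T) y = \sum_(j | f j == y) a j.
Proof.
rewrite sum_ffunE [RHS]big_mkcond; apply: eq_bigr => j _.
rewrite !ffunE eq_sym; case: eqP => _; last exact: mulr0.
exact: mulr1.
Qed.

Lemma word_sum_Xpow v : v = \sum_x v x *: Xpow x.
Proof. by apply/ffunP => y; rewrite sum_XpowE big_pred1_eq. Qed.

Lemma perm_actE t v y : perm_act t v y = v (t^-1%g y).
Proof.
rewrite /perm_act sum_XpowE (big_pred1 (t^-1%g y)) // => x.
by rewrite -(inj_eq (@perm_inj _ t^-1%g)) permK.
Qed.

Lemma perm_actK t : cancel (perm_act t) (perm_act t^-1%g).
Proof. by move=> v; apply/ffunP => y; rewrite !perm_actE invgK permK. Qed.

Lemma perm_actD t : {morph perm_act t : v w / v + w}.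
Proof. by move=> v w; apply/ffunP => y; rewrite !(perm_actE, ffunE). Qed.

Lemma support_perm_act t v :
  [set y | perm_act t v y != 0] = t @: [set x | v x != 0].
Proof.
apply/setP=> y; rewrite inE perm_actE; apply/idP/imsetP.
  by move=> vy; exists (t^-1%g y); rewrite ?inE ?permKV.
by case=> x; rewrite inE => vx ->; rewrite permK.
Qed.

Lemma weight_perm_act t v : weight (perm_act t v) = weight v.
Proof. by rewrite /weight support_perm_act card_imset //; apply: perm_inj. Qed.

Lemma PAut_mem (C : {pred word T}) t v :
  t \in PAut C -> v \in C -> perm_act t v \in C.
Proof.
rewrite inE => /eqP tC vC.
suff : perm_act t v \in perm_act t @: C by rewrite tC inE.
exact: imset_f.
Qed.

Lemma weightB v w : (weight (v - w)%R <= weight v + weight w)%N.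
Proof.
apply: leq_trans (leq_card_setU _ _); apply: subset_leq_card.
apply/subsetP=> x; rewrite !inE !ffunE -negb_and; apply: contraNN.
by case/andP=> /eqP-> /eqP->; rewrite subr0.
Qed.

(** * Minimum distance and unique decoding *)

Lemma min_distance_le (C : {pred word T}) v w :
  v \in C -> w \in C -> v != w -> (min_distance C <= weight (v - w)%R)%N.
Proof.
move=> vC wC nvw.
exact: (@Order.TotalTheory.bigmin_le_cond _ nat _ _ (v, w) _
  (fun p : word T * word T => weight (p.1 - p.2)) (introT and3P (And3 vC wC nvw))).
Qed.

Lemma min_distance_leT (C : {pred word T}) : (min_distance C <= #|T|)%N.
Proof. exact: (@Order.TotalTheory.bigmin_le_id _ nat). Qed.

(** By the triangle inequality two distinct such codewords would be at distance at most 2t, and 2t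
    is less than the minimum distance. *)
Lemma capability_ball_uniq (C : {pred word T}) v w c :
    v \in C -> w \in C ->
    (weight (c - v)%R <= capability C)%N -> (weight (c - w)%R <= capability C)%N ->
  v = w.
Proof.
move=> vC wC cv cw; apply/eqP/negPn/negP => nvw.
have le2t : (weight (v - w)%R <= capability C + capability C)%N.
  have -> : v - w = (c - w) - (c - v) by rewrite opprB [RHS]addrC subrKA.
  exact: leq_trans (weightB _ _) (leq_add cw cv).
have := leq_trans (min_distance_le vC wC nvw) le2t.
have w0 : (0 < weight (v - w)%R)%N.
  rewrite lt0n cards_eq0; apply: contraNneq nvw => /setP v0.
  apply/eqP/ffunP => x; have := v0 x; rewrite !inE !ffunE => /negbFE.
  by rewrite subr_eq0 => /eqP.
(* Positivity of 2t excludes a minimum distance 0, where the truncated [0 - 1] would give t = 0;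
   otherwise 2t is at most d - 1. *)
have := leq_trans w0 le2t; rewrite addnn -muln2 /capability.
have := leq_divM (min_distance C - 1) 2.
case: (min_distance C) => [|d]; first by rewrite sub0n div0n.
by rewrite subn1 /= => led _ /leq_trans/(_ led); rewrite ltnn.
Qed.

(** * Syndromes and information sets *)

Variables (r : nat) (H : 'M['F_2]_(r, #|T|)).

Lemma syndromeE v i :
  (H *m (word_row v)^T) i 0 = \sum_x H i (enum_rank x) * v x.
Proof.
rewrite mxE (reindex (@enum_rank T)) /=; last exact/onW_bij/enum_rank_bij.
by apply: eq_bigr => x _; rewrite !mxE enum_rankK.
Qed.

(** Each row of [H] is orthogonal to the code, so the codeword contributes nothing to the
    syndrome. *)
Lemma syndrome_weight_addl (C : {vspace word T}) c v :
  parity_check C H -> c \in C ->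
  syndrome_weight H (c + v) = syndrome_weight H v.
Proof.
case=> _ Hdual cC; congr #|pred_of_set _|; apply/setP => i; rewrite !inE.
suff Hc : \sum_x H i (enum_rank x) * c x = 0.
  congr (_ != 0); rewrite !syndromeE.
  under eq_bigr => x _ do rewrite ffunE mulrDr.
  by rewrite big_split /= [X in X + _]Hc add0r.
have : row_word H i \in dual_code C.
  by rewrite -Hdual memv_span // map_f ?mem_enum.
rewrite inE => /forall_inP/(_ c cC)/eqP; apply: etrans.
by apply: eq_bigr => x _; rewrite ffunE.
Qed.

Lemma syndrome_weight_standard (I : {set T}) v :
  standard_form I H -> {in I, forall x, v x = 0} ->
  syndrome_weight H v = weight v.
Proof.
case=> f [f_inj f_im Hf] vI.
(* Positions in [I] contribute 0; among the others, row [i] of [H] has its single 1 at position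
   [f i]. *)
have Hv i : (H *m (word_row v)^T) i 0 = v (f i).
  rewrite syndromeE (bigID [in I]) /= big1 ?add0r; last first.
    by move=> x /vI->; rewrite mulr0.
  rewrite (eq_bigl [in f @: [set: 'I_r]]); last by move=> x; rewrite f_im inE.
  rewrite big_imset /=; last by move=> ? ? _ _; apply: f_inj.
  rewrite (bigD1 i) ?inE //= big1 ?addr0 => [|j /andP[_ nij]].
    by have /colP/(_ i) := Hf i; rewrite !mxE eqxx mulr1n => ->; rewrite mul1r.
  have /colP/(_ i) := Hf j.
  by rewrite !mxE eq_sym (negPf nij) => ->; rewrite mul0r.
rewrite /syndrome_weight /weight -(card_imset _ f_inj); congr #|pred_of_set _|.
apply/setP=> x; rewrite inE; apply/imsetP/idP.
  by case=> i; rewrite inE Hv => vf ->.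
move=> vx; have : x \in f @: [set: 'I_r].
  by rewrite f_im inE; apply: contra_neqN vx => /vI.
by case/imsetP=> i _ def_x; exists i; rewrite // inE Hv -def_x.
Qed.

Lemma info_setP (C : {vspace word T}) (I : {set T}) v :
  info_set C I -> exists2 c, c \in C & {in I, forall x, c x = v x}.
Proof.
case=> _ pC; have : projection I v \in projection I @: C by rewrite pC inE.
case/imsetP=> c cC /ffunP pv; exists c => // x xI.
by have := pv (Sub x xI); rewrite !ffunE.
Qed.

End Words.

(** * Powers of the generator and permutations fixing 0 *)

Section AffineInvariant.
Variables (G : finFieldType) (alpha : {unit G}).
Hypothesis gen_alpha : generator [set: {unit G}] alpha.
Let n := #|G|.-1.

Lemma ext0_unit (p : {perm {unit G}}) (u : {unit G}) : ext0 p (val u) = val (p u).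
Proof. by rewrite permE /ext0_fun valK. Qed.

Lemma ext0_0 (p : {perm {unit G}}) : ext0 p 0 = 0.
Proof. by rewrite permE /ext0_fun insubF // unitr0. Qed.

Lemma order_alpha : #[alpha]%g = n.
Proof. by rewrite /order -(eqP gen_alpha) card_finField_unit. Qed.

Lemma unit_pow_alpha (u : {unit G}) :
  exists2 k, (k < n)%N & u = (alpha ^+ k)%g.
Proof.
have : u \in <[alpha]>%g by rewrite -(eqP gen_alpha) inE.
by case/cyclePmin=> k; rewrite order_alpha => ltk ->; exists k.
Qed.

Lemma alpha_pow_bij : bijective (fun i : 'I_n => (alpha ^+ i)%g).
Proof.
apply: inj_card_bij => [i j /eqP|].
  by rewrite eq_expg_mod_order order_alpha !modn_small // => /eqP/val_inj.
by rewrite card_ord -cardsT card_finField_unit.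
Qed.

Lemma big_field_units (V : nmodType) (F : G -> V) :
  \sum_x F x = F 0 + \sum_(u : {unit G}) F (val u).
Proof.
rewrite (bigD1 0) //=; congr (_ + _).
(* The default [1] of [insubd] is never taken: the remaining indices are nonzero, hence units. *)
rewrite (reindex_onto val (insubd (1%g : {unit G}))) /=; last first.
  by move=> x x0; rewrite insubdK // [_ \in _]unitfE.
apply: eq_bigl => u; rewrite valKd eqxx andbT.
by have := valP u; rewrite /= unitfE.
Qed.

Lemma big_alpha_pow (V : nmodType) (F : G -> V) :
  \sum_(i < n) F (val alpha ^+ i) = \sum_(u : {unit G}) F (val u).
Proof.
rewrite [RHS](reindex (fun i : 'I_n => (alpha ^+ i)%g)) /=; last first.
  exact/onW_bij/alpha_pow_bij.
by apply: eq_bigr => i _; rewrite FinRing.val_unitX.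
Qed.

(** The powers of [alpha] run once through the units, so every word has the shape to which the
    definition of an extended cyclic code applies. *)
Lemma extended_cyclic_parity (C : {vspace word G}) (v : word G) :
  extended_cyclic n alpha C -> v \in C ->
  v 0 + \sum_(u : {unit G}) v (val u) = 0.
Proof.
move=> Ccyc vC; pose a i := v (val alpha ^+ i).
have [|_] := Ccyc (v 0) a; last by rewrite (big_alpha_pow v).
pose F x : word G := v x *: Xpow x.
by rewrite (big_alpha_pow F) -(big_field_units F) -word_sum_Xpow.
Qed.

(* The entry at 0 of a codeword is determined by the others, because the sum of
   all entries is zero. *)
Lemma PAut_star_sub (C : {vspace word G}) :
  extended_cyclic n alpha C -> PAut_star C \subset PAut C.
Proof.
move=> Ccyc; apply/subsetP=> _ /imsetP[p pP ->].
have pC v : v \in C -> perm_act (ext0 p) v \in C.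
  move=> vC; have := PAut_mem pP (imset_f _ vC).
  case/imsetP=> w wC /ffunP pvw.
  have pvw_u (u : {unit G}) : v (val (p^-1%g u)) = w (val u).
    by have := pvw u; rewrite perm_actE !ffunE.
  have v0 : v 0 = w 0.
    have := etrans (extended_cyclic_parity Ccyc vC)
                   (esym (extended_cyclic_parity Ccyc wC)).
    rewrite (reindex_inj (@perm_inj _ p^-1%g)) /=.
    under eq_bigr => u _ do rewrite pvw_u.
    exact: addIr.
  suff -> : perm_act (ext0 p) v = w by [].
  apply/ffunP => x; rewrite perm_actE.
  have [->|x0] := eqVneq x 0.
    by rewrite -[in LHS](ext0_0 p) permK.
  have xU : x \is a GRing.unit by rewrite unitfE.
  have -> : x = ext0 p (val (p^-1%g (Sub x xU : {unit G}))).
    by rewrite ext0_unit permKV.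
  by rewrite permK pvw_u ext0_unit permKV.
(* Inclusion suffices: the action is injective and the code finite, so the image has as many
   elements as the code. *)
have sC : perm_act (ext0 p) @: C \subset [set v in C].
  by apply/subsetP=> _ /imsetP[v vC ->]; rewrite inE pC.
by rewrite inE eqEcard sC (card_imset _ (can_inj (perm_actK _))) cardsE leqnn.
Qed.

(** * Translations and avoidance of the information set *)

Lemma translation_PAut (C : {vspace word G}) b :
  affine_invariant n alpha C -> translation b \in PAut C.
Proof.
case=> _ /(_ 1%g b).
suff -> : affine_perm 1%g b = translation b by [].
by apply/permP=> x; rewrite !permE FinRing.val_unit1 mul1r.
Qed.

(** The identity is the translation by 0, and every nonzero [b] is a power of [alpha] with exponent
    below [n]. *)
Lemma mem_SigmaP (s : {perm G}) :
  reflect (exists b, s = translation b) (s \in Sigma n alpha).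
Proof.
have tr0 : translation 0 = 1%g :> {perm G}.
  by apply/permP=> x; rewrite !permE addr0.
rewrite inE; apply: (iffP orP) => [[/eqP->|/mapP[k _ ->]]|[b ->]].
- by exists 0.
- by exists (val alpha ^+ k).
have [->|b0] := eqVneq b 0; first by left; rewrite tr0.
have bU : b \is a GRing.unit by rewrite unitfE.
have [k ltk bk] := unit_pow_alpha (Sub b bU); right; apply/mapP.
exists k; first by rewrite mem_iota.
by rewrite -FinRing.val_unitX -bk.
Qed.

Lemma PD_like_avoid (C : {vspace word G}) (I E : {set G}) s P :
    PD_like s C (I :\ 0) P -> (#|E| <= s < #|G|)%N ->
  exists st : {perm G} * {perm G},
    [/\ st.1 \in Sigma n alpha, st.2 \in P
      & (st.2 @: (st.1 @: E)) :&: I = set0].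
Proof.
case=> _ Pstar PD /andP[leEs ltsG].
have [a aE] : exists a, a \notin E.
  apply/existsP; rewrite -negb_forall; apply/negP=> /forallP allE.
  have := leq_ltn_trans leEs ltsG; rewrite (_ : E = setT) ?cardsT ?ltnn //.
  by apply/setP=> x; rewrite allE inE.
(* This translation sends [a] to 0; since [a] is outside [E], the image of [E] misses 0. *)
pose sg := translation (- a).
have sE0 : sg @: E \subset ~: [set 0].
  apply/subsetP=> _ /imsetP[x xE ->]; rewrite !inE permE subr_eq0.
  by apply: contraNneq aE => <-.
(* There is room for [s] elements among the nonzero ones, as [s] is at most [#|G| - 1]. *)
have [] := @extend_set _ _ _ s sE0.
  rewrite card_imset ?leEs; last exact: perm_inj.
  by rewrite cardsC1 -ltnS prednK //; apply: leq_trans ltsG.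
move=> B [sEB B0] cardB.
have nB0 : 0 \notin B.
  by apply/negP=> /(subsetP B0); rewrite !inE eqxx.
have [tau tauP tauB] := PD B nB0 cardB.
exists (sg, tau); split=> //; first by apply/mem_SigmaP; exists (- a).
apply/setP=> y; rewrite inE in_set0; apply/negP=> /andP[/imsetP[x xE ->] tI].
have xB := subsetP sEB x xE.
have /imsetP[p _ def_tau] := subsetP Pstar tau tauP.
(* As [tau] fixes 0 and [x] is nonzero, [tau x] is nonzero: a point in [I] would already lie in
   [I :\ 0]. *)
have : tau x \in tau @: B :&: (I :\ 0).
  rewrite inE imset_f // in_setD1 tI andbT -[0](ext0_0 p) -def_tau.
  by rewrite (inj_eq perm_inj); apply: contraNneq nB0 => <-.
by rewrite tauB inE.
Qed.

End AffineInvariant.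

(** * Correctness of the algorithm *)

Theorem theorem13 (m : nat) (hm : (0 < m)%N)
    (G : finFieldType) (hG : #|G| = (2 ^ m)%N)
    (alpha : {unit G}) (halpha : generator [set: {unit G}] alpha)
    (C : {vspace word G}) (hCideal : ga_ideal C) (hC0 : C != 0%VS)
    (hCaff : affine_invariant (2 ^ m - 1) alpha C)
    (I : {set G}) (hI : info_set C I)
    (s : nat) (hs : (s <= capability C)%N)
    (P : {set {perm G}}) (hP : PD_like s C (I :\ 0) P)
    (H : 'M['F_2]_(2 ^ m - \dim C, #|G|))
    (hH : parity_check C H) (hHI : standard_form I H)
    (ps : seq {perm G}) (hps_uniq : uniq ps) (hps : ps =i P)
    (c e : word G) (hc : c \in C) (he : (weight e <= s)%N) :
  algorithmII (2 ^ m - 1) alpha C (capability C) I H ps (c + e) = Some c.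
Proof.
have nE : (2 ^ m - 1)%N = #|G|.-1 by rewrite hG subn1.
rewrite nE in hCaff *; have [Ccyc _] := hCaff.
have PAutP t : t \in P -> t \in PAut C.
  case: hP => _ /subsetP Pstar _ /Pstar.
  exact: (subsetP (PAut_star_sub halpha Ccyc)).
have SigmaP st : st \in Sigma #|G|.-1 alpha -> st \in PAut C.
  by case/(mem_SigmaP halpha)=> b ->; apply: translation_PAut hCaff.
rewrite /algorithmII.
set test := (fun p : {perm G} * {perm G} => leq _ _); set L := [seq _ | _ <- _, _ <- _].
have has_test : has test L.
  (* The minimum distance is at most [#|G|], its default value, so t is at most [#|G| - 1]. *)
  have ltsG : (s < #|G|)%N.
    apply: (leq_ltn_trans hs); rewrite /capability.
    have Gpos : (0 < #|G|)%N by rewrite hG expn_gt0.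
    rewrite -(prednK Gpos) ltnS; apply: leq_trans (leq_div _ _) _.
    by rewrite subn1 -!subn1 leq_sub2r // min_distance_leT.
  have Es : (#|[set x | e x != 0%R]| <= s < #|G|)%N by rewrite he ltsG.
  have [[sg tau] /= [sgS tauP avoid]] := PD_like_avoid halpha hP Es.
  apply/hasP; exists (sg, tau); first by apply: allpairs_f; rewrite ?hps.
  rewrite /test /= !perm_actD (syndrome_weight_addl _ hH); last first.
    exact: PAut_mem (PAutP _ tauP) (PAut_mem (SigmaP _ sgS) hc).
  rewrite (syndrome_weight_standard hHI) ?weight_perm_act.
    exact: leq_trans hs.
  move=> x xI; apply/eqP/negPn/negP => ex.
  have := in_set0 x; rewrite -avoid inE xI -!support_perm_act inE.
  by rewrite ex.
case defF: [seq p <- L | test p] => [|[sg tau] F] /=.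
  by move: has_test; rewrite has_filter defF.
(* All that matters about the pair found is that it passes the test, so the order of the search has
   no influence on the output. *)
have : (sg, tau) \in [seq p <- L | test p] by rewrite defF mem_head.
rewrite mem_filter => /andP[]; rewrite /test /= => test_st.
case/allpairsP=> -[sg' tau'] /= [sgS tauP [eq_sg eq_tau]].
move: sgS tauP; rewrite -{}eq_sg -{}eq_tau hps => /SigmaP sgP /PAutP tauP.
set w := perm_act tau _ in test_st *; set c1 := perm_act tau (perm_act sg c).
have c1C : c1 \in C by exact: PAut_mem tauP (PAut_mem sgP hc).
have decode c' : c' \in C -> {in I, forall x, c' x = w x} -> c' = c1.
  move=> c'C c'I; apply: (@capability_ball_uniq _ C _ _ w) => //.
    (* [w - c'] vanishes on [I], so its weight is its syndrome weight, which is that of [w] and is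
       bounded by the test. *)
    rewrite -(syndrome_weight_standard hHI); last first.
      by move=> x xI; rewrite !ffunE c'I // subrr.
    by rewrite addrC (syndrome_weight_addl _ hH) // rpredN.
  (* [w - c1] is the moved error, of the same weight as [e]. *)
  rewrite /w !perm_actD addrC addKr !weight_perm_act.
  exact: leq_trans hs.
case: pickP => [c' /andP[c'C /forall_inP c'I] /=|no_c'].
  rewrite (decode c') // => [|x /c'I/eqP //].
  by rewrite /c1 !perm_actK.
(* The search for a codeword cannot fail, since the code projects onto all words on [I]. *)
have [c' c'C c'I] := info_setP w hI.
have /negP[] := no_c' c'; rewrite c'C.
by apply/forall_inP=> x /c'I/eqP.
Qed.
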